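(* Let $\mathcal{H}$ be a complex Hilbert space and let $A,D\in\mathcal{B}(\mathcal{H})$ be positive. Then $$\|AD\|\le\left\|\int_0^1\left((1-t)\left(\frac{A+D}{2}\right)^2+t\|AD\|I\right)^2dt\right\|^{1/2}\le\frac14\|A+D\|^2.$$
   Context: $\mathcal{B}(\mathcal{H})$ is the set of bounded linear operators on $\mathcal{H}$, $I$ is the identity operator, and $\|\cdot\|$ is the operator norm. An operator $A$ is positive if $\langle Ax,x\rangle\ge0$ for all $x\in\mathcal{H}$. The integral is the integral over $[0,1]$ of a norm-continuous operator-valued function. *)

(* Defs.v *)
From HB Require Import structures.
From mathcomp Require Import all_boot all_order all_algebra complex.
From mathcomp Require Import all_classical all_reals all_analysis.

Set Implicit Arguments.
Unset Strict Implicit.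
Unset Printing Implicit Defensive.

Import Order.TTheory GRing.Theory Num.Theory.
Import numFieldNormedType.Exports.

Local Open Scope classical_set_scope.
Local Open Scope ring_scope.
Local Open Scope complex_scope.

(* The form [inner] is linear in its first argument and conjugate-linear in
   its second one; the norm is the one it induces. *)
HB.mixin Record isHilbert (R : realType) (H : Type)
    of CompleteNormedModule R[i] H := {
  inner : {dot H for (Num.conj : R[i] -> R[i])} ;
  sqr_norm_inner : forall x : H, `|x| ^+ 2 = inner x x
}.

#[short(type="hilbertType")]
HB.structure Definition Hilbert (R : realType) :=
  {H of CompleteNormedModule R[i] H & isHilbert R H}.

Section bounded_operators.
Variables (R : realType) (H : normedModType R[i]).

Definition bounded_linear (f : H -> H) : Prop :=
  linear f /\ exists M : R, forall x, `|f x| <= M%:C * `|x|.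

Definition bounded_linear_pred : {pred (H -> H)} :=
  [pred f | `[< bounded_linear f >]].

Lemma bounded_linear0 : bounded_linear (0 : H -> H).
Proof.
split=> [a x y|]; first by rewrite /= scaler0 addr0.
by exists 0 => x; rewrite /= normr0 mul0r.
Qed.

Lemma bounded_linear_submod : submod_closed bounded_linear_pred.
Proof.
split; first exact/asboolP/bounded_linear0.
move=> a f g /asboolP[flin [M fM]] /asboolP[glin [N gN]].
have afgE x : (a *: f + g) x = a *: f x + g x by [].
apply/asboolP; split=> [b x y|].
  by rewrite !afgE flin glin !scalerDr !scalerA mulrC addrACA.
exists (complex.Re `|a| * M + N) => x.
have aE : (complex.Re `|a|)%:C = `|a| by rewrite RRe_real ?normr_real.
rewrite afgE (le_trans (ler_normD _ _))// normrZ rmorphD rmorphM.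
by rewrite [X in X * _]aE mulrDl -mulrA lerD// ler_wpM2l.
Qed.

HB.instance Definition _ :=
  GRing.isSubmodClosed.Build _ _ bounded_linear_pred bounded_linear_submod.

Record bop := Bop { bop_fun :> H -> H ; _ : bop_fun \in bounded_linear_pred }.

HB.instance Definition _ := [isSub for bop_fun].
HB.instance Definition _ := [Choice of bop by <:].
HB.instance Definition _ := [SubChoice_isSubLmodule of bop by <:].

Lemma bopP (A : bop) : bounded_linear A.
Proof. exact/asboolP/(valP A). Qed.

Lemma bop_eqP (A B : bop) : A =1 B -> A = B.
Proof. by move=> AB; apply/val_inj/funext. Qed.

Lemma bopD (A B : bop) x : (A + B) x = A x + B x. Proof. by []. Qed.

Lemma bopZ c (A : bop) x : (c *: A) x = c *: A x. Proof. by []. Qed.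

Lemma bop0 x : (0 : bop) x = 0. Proof. by []. Qed.

Lemma bop_linear (A : bop) : linear A. Proof. by case: (bopP A). Qed.

HB.instance Definition _ (A : bop) :=
  GRing.isLinear.Build _ _ _ _ (bop_fun A) (bop_linear A).

Lemma bop_one_subproof : bounded_linear (@id H).
Proof. by split=> //; exists 1 => x; rewrite mul1r. Qed.

Definition bop_one : bop := Bop (asboolT bop_one_subproof).

Lemma bop_mul_subproof (A B : bop) : bounded_linear (A \o B).
Proof.
have [_ [M AM]] := bopP A; have [_ [N BN]] := bopP B.
split=> [c x y|]; first by rewrite /= !linearP.
exists (`|M| * `|N|) => x; rewrite /= (le_trans (AM _))//.
rewrite rmorphM/= -mulrA (@le_trans _ _ (`|M|%:C * `|B x|))//.
  by rewrite ler_wpM2r// lecR ler_norm.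
rewrite ler_wpM2l ?lecR// (le_trans (BN x))// ler_wpM2r// lecR ler_norm//.
Qed.

Definition bop_mul (A B : bop) : bop :=
  Bop (asboolT (bop_mul_subproof A B)).

Fact bop_mulA : associative bop_mul.
Proof. by move=> A B C; apply: bop_eqP. Qed.

Fact bop_mul1l : left_id bop_one bop_mul.
Proof. by move=> A; apply: bop_eqP. Qed.

Fact bop_mul1r : right_id bop_one bop_mul.
Proof. by move=> A; apply: bop_eqP. Qed.

Fact bop_mulDl : left_distributive bop_mul +%R.
Proof. by move=> A B C; apply: bop_eqP. Qed.

Fact bop_mulDr : right_distributive bop_mul +%R.
Proof. by move=> A B C; apply: bop_eqP => x; apply: linearD. Qed.

(* Products of operators are compositions and [1] is the identity operator. As
   [H] may be trivial, [bop] is only a possibly trivial ring. *)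
HB.instance Definition _ := GRing.Zmodule_isPzRing.Build bop
  bop_mulA bop_mul1l bop_mul1r bop_mulDl bop_mulDr.

Definition unit_ball_norms (A : bop) : set R :=
  [set complex.Re `|A x| | x in [set x | `|x| <= 1]].

Definition opnorm (A : bop) : R := sup (unit_ball_norms A).

Lemma ReK_norm (x : H) : (complex.Re `|x|)%:C = `|x|.
Proof. by rewrite RRe_real ?normr_real. Qed.

Lemma Re_norm_ge0 (x : H) : 0 <= complex.Re `|x|.
Proof. by rewrite -lecR ReK_norm; exact: normr_ge0. Qed.

Lemma unit_ball_norms_has_sup (A : bop) : has_sup (unit_ball_norms A).
Proof.
split.
  by exists (complex.Re `|A 0|); exists 0; rewrite /= ?normr0.
have [_ [M AM]] := bopP A; exists `|M| => _ [x /= x1 <-].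
rewrite -lecR ReK_norm (le_trans (AM x))//.
rewrite (@le_trans _ _ (`|M|%:C * `|x|))//.
  by rewrite ler_wpM2r// lecR ler_norm.
by rewrite ler_piMr// lecR.
Qed.

Lemma opnorm_ge0 (A : bop) : 0 <= opnorm A.
Proof.
apply: (le_trans (Re_norm_ge0 (A 0))).
apply: (sup_upper_bound (unit_ball_norms_has_sup A)).
by exists 0; rewrite /= ?normr0.
Qed.

Lemma opnorm_le (A : bop) (M : R) :
  (forall x, `|x| <= 1 -> `|A x| <= M%:C) -> opnorm A <= M.
Proof.
move=> AM; apply: ge_sup; first by case: (unit_ball_norms_has_sup A).
by move=> _ [x /= x1 <-]; rewrite -lecR ReK_norm AM.
Qed.

Lemma opnorm_ub_ball (A : bop) x : `|x| <= 1 -> `|A x| <= (opnorm A)%:C.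
Proof.
move=> x1; rewrite -ReK_norm lecR.
by apply: (sup_upper_bound (unit_ball_norms_has_sup A)); exists x.
Qed.

Lemma opnorm_ub (A : bop) x : `|A x| <= (opnorm A)%:C * `|x|.
Proof.
have [->|x0] := eqVneq x 0; first by rewrite linear0 !normr0 mulr0.
have nx0 : 0 < `|x| by rewrite normr_gt0.
rewrite -ler_pdivrMr// -[`|x| in X in X <= _]normr_id mulrC -normfV -normrZ.
rewrite -linearZ; apply: opnorm_ub_ball.
by rewrite normrZ normfV normr_id mulVf ?gt_eqF.
Qed.

Fact opnormD (A B : bop) :
  (opnorm (A + B))%:C <= (opnorm A)%:C + (opnorm B)%:C.
Proof.
rewrite -rmorphD lecR; apply: opnorm_le => x x1.
rewrite rmorphD bopD (le_trans (ler_normD _ _))//.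
by rewrite lerD ?opnorm_ub_ball.
Qed.

Lemma opnormZ_le c (A : bop) : (opnorm (c *: A))%:C <= `|c| * (opnorm A)%:C.
Proof.
have cE : (complex.Re `|c|)%:C = `|c| by rewrite RRe_real ?normr_real.
rewrite -cE -rmorphM lecR; apply: opnorm_le => x x1.
by rewrite bopZ normrZ rmorphM/= cE ler_wpM2l// opnorm_ub_ball.
Qed.

Fact opnormZ c (A : bop) : (opnorm (c *: A))%:C = `|c| * (opnorm A)%:C.
Proof.
apply/eqP; rewrite eq_le opnormZ_le/=.
have [->|c0] := eqVneq c 0; first by rewrite normr0 mul0r lecR opnorm_ge0.
rewrite -ler_pdivlMl ?normr_gt0// -normfV.
by rewrite -[A in X in X <= _](scalerK c0) opnormZ_le.
Qed.

Fact opnorm_eq0 (A : bop) : (opnorm A)%:C = 0 -> A = 0.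
Proof.
move=> A0; apply: bop_eqP => x; apply/eqP; rewrite -normr_le0.
by rewrite (le_trans (opnorm_ub A x))// A0 mul0r.
Qed.

(* Norms over [R[i]] are valued in [R[i]], hence the injection of [R]. *)
HB.instance Definition _ := Lmodule_isNormed.Build R[i] bop
  opnormD opnormZ opnorm_eq0.

End bounded_operators.

(* Order on [R[i]]: [0 <= z] means that [z] is real and nonnegative. *)
Definition positive (R : realType) (H : hilbertType R) (A : bop H) : Prop :=
  forall x : H, 0 <= inner (A x) x.

Section riemann_integral.
Variables (R : realType) (V : normedModType R[i]).
Implicit Types (f : R -> V) (a b : R).

(* The partition is a = s_0 < s_1 < ... < s_n = b, with [s] listing s_1, ...,
   s_n, and the tag [xi i] lies in the i-th cell, for i < n. *)
Definition riemann_sum f a (s : seq R) (xi : nat -> R) : V :=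
  \sum_(i < size s) (nth a s i - nth a (a :: s) i)%:C *: f (xi i).

Definition is_riemann_integral f a b (v : V) : Prop :=
  forall e : R, 0 < e -> exists2 d : R, 0 < d &
    forall (s : seq R) (xi : nat -> R), itv_partition a b s ->
      (forall i, (i < size s)%N -> nth a (a :: s) i <= xi i <= nth a s i) ->
      (forall i, (i < size s)%N -> nth a s i - nth a (a :: s) i < d) ->
      `|riemann_sum f a s xi - v| < e%:C.

(* The value is [0] when the Riemann sums of [f] do not converge. *)
Definition riemann_integral f a b : V := xget 0 (is_riemann_integral f a b).

End riemann_integral.

(* Main.v *)
(** Write [M = (A + D) / 2], [P = M ^ 2] and [c = |AD|]. The integral is
    [Q = (P ^ 2 + c P + c ^ 2) / 3], and [Q - c P = (P - c) ^ 2 / 3 >= 0], so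
    [|Q| >= c |M| ^ 2]; the triangle inequality bounds [|Q|] above as soon as
    [c <= |M| ^ 2]. Hence both inequalities follow from [c <= |M| ^ 2], that is
    [4 |AD| <= |A + D| ^ 2]. For this, let [|x| <= 1], [u = D x], [v = A u], and
    test [A + D] on [w = |v| u + |u| v], on the bisector of [u] and [v]: the
    Cauchy-Schwarz inequalities of the forms of [A], at [u] and [w], and of
    [D], at [x] and [w], bound [<A w, w>] and [<D w, w>] below. *)

Require Import Defs.
From mathcomp Require Import all_boot all_order all_algebra complex ring lra.
From mathcomp Require Import all_classical all_reals all_analysis.

Import Order.TTheory GRing.Theory Num.Theory.
Import numFieldNormedType.Exports.

Local Open Scope ring_scope.
Local Open Scope complex_scope.

(** * The real part of the inner product, and the bound [4 |AD| <= |A + D| ^ 2] *)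

Section real_inner_product.
Context {R : realType} {H : hilbertType R}.
Implicit Types (x y z : H) (a : R) (T : bop H).

(** The real part is a symmetric real bilinear form inducing the same norm, so estimates can be
    carried out in the ordered field [R]. *)
Definition rinner x y : R := complex.Re (inner x y).

Definition rnorm x : R := complex.Re `|x|.

Lemma rnormE x : (rnorm x)%:C = `|x|.
Proof. exact: ReK_norm. Qed.

Lemma rnorm_ge0 x : 0 <= rnorm x.
Proof. exact: Re_norm_ge0. Qed.

Lemma rinnerDl x y z : rinner (x + y) z = rinner x z + rinner y z.
Proof. by rewrite /rinner linearDl raddfD. Qed.

Lemma rinnerC x y : rinner x y = rinner y x.
Proof.
have -> : rinner x y = complex.Re (inner y x)^*%C.
  by rewrite /rinner (hermC inner x y) expr0 mul1r.
by rewrite /rinner; case: (inner y x).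
Qed.

Lemma rinnerDr x y z : rinner x (y + z) = rinner x y + rinner x z.
Proof. by rewrite !(rinnerC x) rinnerDl. Qed.

Lemma rinnerZl a x y : rinner (a%:C *: x) y = a * rinner x y.
Proof.
rewrite /rinner (_ : inner (a%:C *: x) y = a%:C * inner x y); last first.
  exact: linearZl_LR.
case: (inner x y) => b c /=; ring.
Qed.

Lemma rinnerZr a x y : rinner x (a%:C *: y) = a * rinner x y.
Proof. by rewrite !(rinnerC x) rinnerZl. Qed.

Lemma rinnerxx x : rinner x x = rnorm x ^+ 2.
Proof. by rewrite /rinner -sqr_norm_inner -rnormE -rmorphXn. Qed.

Lemma positive_rinner_ge0 T x : positive T -> 0 <= rinner (T x) x.
Proof. by move/(_ x); rewrite lecE /= => /andP[]. Qed.

Lemma positive_rinner_sym T x y : positive T ->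
  rinner (T x) y = rinner (T y) x.
Proof.
move=> T0; have Im0 z : complex.Im (inner (T z) z) = 0.
  by have := T0 z; rewrite lecE /= => /andP[/eqP].
have innerZl c (u v : H) : inner (c *: u) v = c * inner u v.
  exact: linearZl_LR.
have innerZr c (u v : H) : inner u (c *: v) = c^*%C * inner u v.
  exact: linearZr_LR.
have innerDl (u v w : H) : inner (u + v) w = inner u w + inner v w.
  exact: linearDl.
have innerDr (u v w : H) : inner u (v + w) = inner u v + inner u w.
  exact: linearDr.
have TE : T (x + 'i *: y) = T x + 'i *: T y by rewrite linearD linearZ.
(* Reality of [<T (x + i y), x + i y>] is the claim: its imaginary part is
   [Re <T y, x> - Re <T x, y>], up to [Im <T x, x>] and [Im <T y, y>]. *)
have := Im0 (x + 'i *: y).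
rewrite TE innerDl !innerDr !innerZl !innerZr.
have := Im0 x; have := Im0 y; rewrite /rinner.
case: (inner (T x) x) => ? ?; case: (inner (T y) y) => ? ?.
case: (inner (T x) y) => ? ?; case: (inner (T y) x) => ? ? /=.
lra.
Qed.

(** Makes the usual Cauchy-Schwarz inequality the case [T = 1] of the one for positive operators. *)
Lemma positive1 : positive (1 : bop H).
Proof. by move=> x; rewrite -sqr_norm_inner exprn_ge0. Qed.

(** Discriminant argument: [<T (x + s y), x + s y>] is a quadratic polynomial in the real [s] that
    is never negative. *)
Lemma positive_cauchy_schwarz T x y : positive T ->
  rinner (T x) y ^+ 2 <= rinner (T x) x * rinner (T y) y.
Proof.
move=> T0; set p := rinner (T x) x; set q := rinner (T x) y.
set r := rinner (T y) y.
have pqr s : 0 <= p + 2 * s * q + s ^+ 2 * r.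
  have := positive_rinner_ge0 T (x + s%:C *: y) T0.
  have -> : T (x + s%:C *: y) = T x + s%:C *: T y by rewrite linearD linearZ.
  rewrite !rinnerDl !rinnerDr !rinnerZl !rinnerZr.
  rewrite (positive_rinner_sym T y x T0) -/p -/q -/r.
  by congr (_ <= _); ring.
have r0 : 0 <= r by exact: positive_rinner_ge0.
have [r_eq0|r_neq0] := eqVneq r 0.
  have p0 : 0 <= p by exact: positive_rinner_ge0.
  have [->|q0] := eqVneq q 0; first by rewrite expr0n mulr_ge0.
  (* With [r = 0] the polynomial is affine in [s]; at this point it would equal [-1]. *)
  have := pqr (- (p + 1) / (2 * q)).
  have -> : 2 * (- (p + 1) / (2 * q)) * q = - (p + 1) by field.
  rewrite r_eq0; lra.
have rgt0 : 0 < r by rewrite lt_neqAle eq_sym r_neq0.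
(* The minimizer of the polynomial. *)
have := pqr (- q / r).
have -> : p + 2 * (- q / r) * q + (- q / r) ^+ 2 * r = (p * r - q ^+ 2) / r.
  by field.
by rewrite pmulr_lge0 ?invr_gt0// subr_ge0.
Qed.

Lemma rnorm_bop_le T x : rnorm (T x) <= opnorm T * rnorm x.
Proof. by rewrite -lecR rmorphM /= !rnormE opnorm_ub. Qed.

Lemma rinner_le x y : rinner x y <= rnorm x * rnorm y.
Proof.
have := positive_cauchy_schwarz 1 x y positive1.
rewrite /= !rinnerxx -exprMn => xy; apply: le_trans (ler_norm _) _.
by rewrite -(ler_pXn2r (ltn0Sn 1)) ?nnegrE ?mulr_ge0 ?rnorm_ge0//
  real_normK ?num_real.
Qed.

Lemma rinner_bop_le T x : rinner (T x) x <= opnorm T * rnorm x ^+ 2.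
Proof.
apply: le_trans (rinner_le _ _) _.
by rewrite expr2 mulrA ler_wpM2r ?rnorm_ge0 ?rnorm_bop_le.
Qed.

Lemma opnorm_rnorm_le T (k : R) :
  (forall x, rnorm x <= 1 -> rnorm (T x) <= k) -> opnorm T <= k.
Proof.
move=> Tk; apply: opnorm_le => x x1; rewrite -rnormE lecR Tk//.
by rewrite -lecR rnormE.
Qed.

Lemma opnorm_mul_le (S T : bop H) : opnorm (S * T) <= opnorm S * opnorm T.
Proof.
apply: opnorm_rnorm_le => x x1.
apply: le_trans (rnorm_bop_le S _) _; rewrite ler_wpM2l ?opnorm_ge0//.
by apply: le_trans (rnorm_bop_le T x) _; rewrite ler_piMr ?opnorm_ge0.
Qed.

(** Not an equality in general: the norm of [1] is [0] when [H] is trivial. *)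
Lemma opnorm1_le : opnorm (1 : bop H) <= 1.
Proof. by apply: opnorm_rnorm_le. Qed.

Lemma rinner_sqr_rnorm_le T x y : positive T -> rnorm x <= 1 ->
  rinner (T x) y ^+ 2 <= rnorm (T x) * rinner (T y) y.
Proof.
move=> T0 x1; apply: le_trans (positive_cauchy_schwarz T x y T0) _.
apply: ler_wpM2r; first exact: positive_rinner_ge0.
apply: le_trans (rinner_le _ _) _.
by rewrite ler_piMr ?rnorm_ge0.
Qed.

Lemma opnorm_mul_positive_le (A D : bop H) : positive A -> positive D ->
  4 * opnorm (A * D) <= opnorm (A + D) ^+ 2.
Proof.
move=> A0 D0; set N := opnorm (A + D).
rewrite -ler_pdivlMl//; apply: opnorm_rnorm_le => x x1 /=.
rewrite ler_pdivlMl//.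
set u := D x; set v := A u; set r := rnorm v; set s := rnorm u.
have r0 : 0 <= r := rnorm_ge0 v.
have s0 : 0 <= s := rnorm_ge0 u.
have [->|r_neq0] := eqVneq r 0; first by rewrite mulr0 sqr_ge0.
have [s_eq0|s_neq0] := eqVneq s 0.
  have := rnorm_bop_le A u; rewrite -/v -/r -/s s_eq0 mulr0 => r_le0.
  by case/eqP: r_neq0; apply/eqP; rewrite eq_le r_le0.
have rp : 0 < r by rewrite lt_neqAle eq_sym r_neq0.
have sp : 0 < s by rewrite lt_neqAle eq_sym s_neq0.
(* With this [w], the same factor [K = k + r * s] comes out of [<v, w>], [<u, w>] and [|w| ^ 2], and
   cancels at the end. *)
pose k := rinner v u; pose w := r%:C *: u + s%:C *: v.
have k0 : 0 <= k by exact: positive_rinner_ge0.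
have vw : rinner v w = r * (k + r * s).
  rewrite /w rinnerDr !rinnerZr rinnerxx -/k -/r; ring.
have uw : rinner u w = s * (k + r * s).
  rewrite /w rinnerDr !rinnerZr rinnerxx (rinnerC u v) -/k -/s; ring.
have ww : rnorm w ^+ 2 = 2 * r * s * (k + r * s).
  rewrite -rinnerxx {1}/w rinnerDl !rinnerZl vw uw; ring.
pose a := rinner (A w) w; pose d := rinner (D w) w.
have a0 : 0 <= a by exact: positive_rinner_ge0.
have d0 : 0 <= d by exact: positive_rinner_ge0.
set K := k + r * s in vw uw ww.
have rs : 0 < r * s by rewrite mulr_gt0.
have Kp : 0 < K by rewrite ltr_wpDl.
have csA : (r * K) ^+ 2 <= k * a.
  by rewrite -vw; exact: positive_cauchy_schwarz.
(* Cauchy-Schwarz for [D] gives [(s * K) ^ 2 <= s * d], since [<D x, x> <= |D x| = s]; then divide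
   by [s]. *)
have csD : s * K ^+ 2 <= d.
  have := rinner_sqr_rnorm_le D x w D0 x1.
  by rewrite -/u -/s -/d uw exprMn expr2 -mulrA ler_pM2l.
have ad : a + d <= N * (2 * r * s * K).
  by rewrite /a /d -rinnerDl -ww; exact: (rinner_bop_le (A + D)).
have kp : 0 < k.
  rewrite lt_neqAle k0 andbT; apply/eqP => k_eq0; move: csA.
  by rewrite -k_eq0 mul0r leNgt exprn_gt0// mulr_gt0.
(* Arithmetic-geometric mean: [4 * a * d <= (a + d) ^ 2]. *)
have ad4 : a * d <= N ^+ 2 * (r * s * K) ^+ 2.
  have : (a + d) ^+ 2 <= (N * (2 * r * s * K)) ^+ 2.
    by rewrite ler_pXn2r// nnegrE ?(le_trans _ ad)// addr_ge0.
  have := sqr_ge0 (a - d); nra.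
(* The product of [csA] and [csD], with [a * d] eliminated by [ad4]; dividing by [r ^ 2 * s * K ^ 2]
   yields [K2]. *)
have prod : (r * K) ^+ 2 * (s * K ^+ 2) <= k * (N ^+ 2 * (r * s * K) ^+ 2).
  apply: (@le_trans _ _ (k * a * d)).
    apply: ler_pM => //; first exact: sqr_ge0.
    by rewrite mulr_ge0// sqr_ge0.
  by rewrite -mulrA ler_pM2l.
have K2 : K ^+ 2 <= k * s * N ^+ 2.
  rewrite -(ler_pM2l (_ : 0 < r ^+ 2 * s * K ^+ 2)); last first.
    by rewrite !mulr_gt0 ?exprn_gt0.
  have -> : r ^+ 2 * s * K ^+ 2 * K ^+ 2 = (r * K) ^+ 2 * (s * K ^+ 2) by ring.
  have -> : r ^+ 2 * s * K ^+ 2 * (k * s * N ^+ 2) =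
    k * (N ^+ 2 * (r * s * K) ^+ 2) by ring.
  exact: prod.
(* What remains is [4 * k * (r * s) <= (k + r * s) ^ 2]. *)
rewrite -(ler_pM2l (mulr_gt0 kp sp)); apply: le_trans K2.
rewrite /K; have := sqr_ge0 (k - r * s); nra.
Qed.

End real_inner_product.

(** * Riemann integrals: uniqueness, and evaluation by a primitive *)

Section riemann_integral.
Context {R : realType} {V : normedModType R[i]}.
Implicit Types (f F : R -> V) (a b : R) (s : seq R).

Lemma itv_partition_nth_lt a b s i : itv_partition a b s ->
  (i < size s)%N -> nth a (a :: s) i < nth a s i.
Proof. by move=> [/(pathP a) + _] => /[apply]. Qed.

Lemma itv_partition_nth_ge_left a b s i : itv_partition a b s ->
  (i < size s)%N -> a <= nth a (a :: s) i.
Proof.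
move=> abs si; rewrite (set_nth_default b) /= ?ltnS 1?ltnW//.
by apply: itv_partition_nth_ge abs; rewrite ltnS ltnW.
Qed.

Lemma itv_partition_nth_le_right a b s i : itv_partition a b s ->
  (i < size s)%N -> nth a s i <= b.
Proof.
move=> abs si; rewrite (set_nth_default b)//.
exact: (@itv_partition_nth_le _ _ a b s i.+1).
Qed.

(** Used with [G] a primitive, to split its increment over the cells, and with [G = id], to add up
    the cell lengths. *)
Lemma itv_partition_telescope (U : zmodType) (G : R -> U) a b s :
  itv_partition a b s ->
  \sum_(i < size s) (G (nth a s i) - G (nth a (a :: s) i)) = G b - G a.
Proof.
move=> abs.
rewrite -(big_mkord xpredT
  (fun i => G (nth a (a :: s) i.+1) - G (nth a (a :: s) i))).
rewrite telescope_sumr//= (itv_partition_nth_size a abs)//.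
Qed.

Lemma fine_itv_partition a b (d : R) : a < b -> 0 < d ->
  exists2 s, itv_partition a b s &
    forall i, (i < size s)%N -> nth a s i - nth a (a :: s) i < d.
Proof.
(* Cut [[a, b]] into [n + 1] equal cells, of length [h < d]. The list omits the point [a], hence the
   shift by [S]. *)
move=> ab d0; pose n := Num.truncn ((b - a) / d).
have nd : (b - a) / d < n.+1%:R by exact: truncnS_gt.
pose h := (b - a) / n.+1%:R; pose g i := a + h * i%:R.
have hp : 0 < h by rewrite divr_gt0 ?subr_gt0.
have hd : h < d by rewrite ltr_pdivrMr// mulrC -ltr_pdivrMr.
have nthg i : (i <= n.+1)%N -> nth a (a :: mkseq (g \o S) n.+1) i = g i.
  by case: i => [|i] ni /=; rewrite ?nth_mkseq// /g mulr0 addr0.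
exists (mkseq (g \o S) n.+1) => [|i]; last first.
  rewrite size_mkseq => ni; rewrite nthg 1?ltnW// nth_mkseq//= /g.
  by rewrite opprD addrACA subrr add0r -mulrBr -natrB// subSnn mulr1.
split.
  apply/(pathP a) => i; rewrite size_mkseq => ni.
  by rewrite nthg 1?ltnW// nth_mkseq//= /g ltrD2l ltr_pM2l// ltr_nat//.
apply/eqP; rewrite -nth_last size_mkseq /= nth_mkseq//= /g /h.
by rewrite divfK ?pnatr_eq0// addrC subrK.
Qed.

(** One Riemann sum over a partition fine enough for both limits is within [|v - w| / 2] of each,
    strictly, which is absurd if [v] and [w] differ. *)
Lemma is_riemann_integral_unique f a b v w : a < b ->
  is_riemann_integral f a b v -> is_riemann_integral f a b w -> v = w.
Proof.
move=> ab fv fw; apply/eqP; rewrite -subr_eq0 -normr_le0.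
have vwE : (complex.Re `|v - w|)%:C = `|v - w| by exact: ReK_norm.
rewrite -vwE lecR leNgt; apply/negP => vw0.
have [d1 d10 H1] := fv _ (divr_gt0 vw0 (ltr0Sn _ 1)).
have [d2 d20 H2] := fw _ (divr_gt0 vw0 (ltr0Sn _ 1)).
have [s abs sd] := fine_itv_partition a b (Num.min d1 d2) ab
  ltac:(by rewrite lt_min d10).
pose xi := nth a (a :: s).
have xis i : (i < size s)%N -> nth a (a :: s) i <= xi i <= nth a s i.
  by move=> si; rewrite lexx ltW// (itv_partition_nth_lt _ _ _ _ abs).
have {}H1 : `|riemann_sum f a s xi - v| < (complex.Re `|v - w| / 2)%:C.
  by apply: H1 => // i /sd; rewrite lt_min => /andP[].
have {}H2 : `|riemann_sum f a s xi - w| < (complex.Re `|v - w| / 2)%:C.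
  by apply: H2 => // i /sd; rewrite lt_min => /andP[].
have : `|v - w| < (complex.Re `|v - w|)%:C.
  rewrite [X in _ < X%:C]splitr rmorphD /= (le_lt_trans _ (ltrD H1 H2))//.
  rewrite -(normrN (_ - v)) opprB.
  by apply: le_trans (ler_normD _ _); rewrite addrA subrK.
by rewrite vwE ltxx.
Qed.

Lemma riemann_integral_unique f a b v : a < b ->
  is_riemann_integral f a b v -> riemann_integral f a b = v.
Proof.
move=> ab fv; apply: (is_riemann_integral_unique f a b) => //.
by rewrite /riemann_integral; apply: (xgetPex 0); exists v.
Qed.

(** A quantitative fundamental theorem of calculus: an error quadratic in the length of each cell
    adds up to at most [L * d * (b - a)] for mesh below [d]. *)
Lemma is_riemann_integral_primitive f F (L a b : R) : a < b -> 0 <= L ->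
  (forall x t y, a <= x -> x <= t -> t <= y -> y <= b ->
     `|F y - F x - (y - x)%:C *: f t| <= (L * (y - x) ^+ 2)%:C) ->
  is_riemann_integral f a b (F b - F a).
Proof.
move=> ab L0 FL e e0.
have ba : 0 < b - a by rewrite subr_gt0.
(* [L + 1] instead of [L] keeps the divisor positive and the final bound strict even if [L = 0]. *)
have c0 : 0 < (L + 1) * (b - a) by rewrite mulr_gt0// ltr_wpDl.
exists (e / ((L + 1) * (b - a))) => [|s xi abs xis sd]; first exact: divr_gt0.
set d := e / _ in sd.
have d0 : 0 < d by exact: divr_gt0.
rewrite -(itv_partition_telescope _ F a b s abs) -normrN opprB -sumrB.
apply: (@le_lt_trans _ _ (L * d * (b - a))%:C); last first.
  have eE : d * ((L + 1) * (b - a)) = e by rewrite divfK ?gt_eqF.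
  by rewrite ltcR -eE; have := mulr_gt0 d0 ba; lra.
rewrite -(itv_partition_telescope _ id a b s abs) mulr_sumr rmorph_sum /=.
apply: le_trans (ler_norm_sum _ _ _) _; apply: ler_sum => i _.
have /andP[xi1 xi2] := xis i (ltn_ord i).
apply: (@le_trans _ _ (L * (nth a s i - nth a (a :: s) i) ^+ 2)%:C).
  apply: FL => //.
    exact: itv_partition_nth_ge_left abs _.
  exact: itv_partition_nth_le_right abs _.
rewrite lecR expr2 mulrA ler_wpM2r//.
  by rewrite subr_ge0 (le_trans xi1).
by rewrite ler_wpM2l// ltW// sd.
Qed.

End riemann_integral.

(** * The integral of a quadratic polynomial with vector coefficients *)

Lemma square_sub_le {R : realFieldType} (x t y : R) :
  0 <= x -> x <= t -> t <= y -> y <= 1 ->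
  `|x ^+ 2 + x * y + y ^+ 2 - 3 * t ^+ 2| <= 6 * (y - x).
Proof.
move=> x0 xt ty y1; rewrite ler_norml.
(* Both [x ^ 2 + x * y + y ^ 2], which is [(y ^ 3 - x ^ 3) / (y - x)] if [x < y], and [3 * t ^ 2]
   lie between [3 * x ^ 2] and [3 * y ^ 2]. *)
have xx : x * x <= t * t by nra.
have tt : t * t <= y * y by nra.
have xxy : x * x <= x * y by nra.
have xyy : x * y <= y * y by nra.
have yx : y * y - x * x <= 2 * (y - x) by nra.
by apply/andP; split; lra.
Qed.

Lemma is_riemann_integral_quadratic {R : realType} {V : normedModType R[i]}
    (X Y Z : V) :
  is_riemann_integral (fun t : R => ((1 - t) ^+ 2)%:C *: X
      + (2 * t * (1 - t))%:C *: Y + (t ^+ 2)%:C *: Z)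
    0 1 (3^-1%:C *: (X + Y + Z)).
Proof.
(* Working with triples of coefficients reduces the vector estimate to three scalar ones. *)
pose comb (a b c : R) := a%:C *: X + b%:C *: Y + c%:C *: Z.
have combB a b c a' b' c' :
    comb a b c - comb a' b' c' = comb (a - a') (b - b') (c - c').
  rewrite /comb !rmorphB !scalerBl !opprD addrACA; congr (_ + _).
  by rewrite addrACA.
have combZ d a b c : d%:C *: comb a b c = comb (d * a) (d * b) (d * c).
  by rewrite /comb !scalerDr !scalerA !rmorphM.
have combE a b c a' b' c' : a = a' -> b = b' -> c = c' ->
    comb a b c = comb a' b' c' by move=> -> -> ->.
pose nrm (v : V) := complex.Re `|v|.
have nrmE v : (nrm v)%:C = `|v| := ReK_norm v.
have nrm0 v : 0 <= nrm v := Re_norm_ge0 v.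
have comb_le a b c : `|comb a b c|
    <= (`|a| * nrm X + `|b| * nrm Y + `|c| * nrm Z)%:C.
  have normCZ (k : R) v : (`|k| * nrm v)%:C = `|k%:C *: v|.
    by rewrite normrZ rmorphM /= nrmE normc_def /= expr0n addr0 sqrtr_sqr.
  rewrite !rmorphD /= -!/(_%:C) !normCZ.
  by rewrite (le_trans (ler_normD _ _))// lerD2r ler_normD.
(* The coefficients are primitives of [(1 - t) ^ 2], [2 * t * (1 - t)] and [t ^ 2]; each increases
   by [1 / 3] over [[0, 1]]. *)
pose F (t : R) :=
  comb (- (1 - t) ^+ 3 / 3) (t ^+ 2 - 2 * t ^+ 3 / 3) (t ^+ 3 / 3).
have -> : 3^-1%:C *: (X + Y + Z) = F 1 - F 0.
  have -> : X + Y + Z = comb 1 1 1 by rewrite /comb !scale1r.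
  by rewrite combZ combB; apply: combE; field.
(* The weights are the constants of the bounds [b1], [b2] and [b3] below. *)
pose L := 2 * nrm X + 6 * nrm Y + 2 * nrm Z.
apply: (@is_riemann_integral_primitive _ _ _ F L) => //.
  by rewrite !addr_ge0// mulr_ge0.
move=> x t y x0 xt ty y1.
have yx0 : 0 <= y - x by rewrite subr_ge0 (le_trans xt).
pose k1 := - (1 - y) ^+ 3 / 3 + (1 - x) ^+ 3 / 3 - (y - x) * (1 - t) ^+ 2.
pose k2 := y ^+ 2 - 2 * y ^+ 3 / 3 - (x ^+ 2 - 2 * x ^+ 3 / 3)
  - (y - x) * (2 * t * (1 - t)).
pose k3 := y ^+ 3 / 3 - x ^+ 3 / 3 - (y - x) * t ^+ 2.
rewrite -/(comb _ _ _) combZ !combB.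
rewrite (combE _ _ _ k1 k2 k3)//; last by rewrite /k1; field.
have b1 : `|k1| <= 2 * (y - x) ^+ 2.
  have -> : k1 = (y - x) * (((1 - y) ^+ 2 + (1 - y) * (1 - x) + (1 - x) ^+ 2
      - 3 * (1 - t) ^+ 2) / 3) by rewrite /k1; field.
  (* The reflection of [t] to [1 - t] reduces this term to the estimate for squares. *)
  have := square_sub_le (1 - y) (1 - t) (1 - x).
  rewrite !subr_ge0 !lerD2l !lerN2 gerBl => /(_ y1 ty xt x0) h.
  have -> : 2 * (y - x) ^+ 2 = (y - x) * (2 * (y - x)) by ring.
  rewrite normrM (ger0_norm yx0) ler_wpM2l// normrM.
  by rewrite normfV (ger0_norm (ler0n _ 3)) ler_pdivrMr//; lra.
have b3 : `|k3| <= 2 * (y - x) ^+ 2.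
  have -> : k3 = (y - x) * ((x ^+ 2 + x * y + y ^+ 2 - 3 * t ^+ 2) / 3).
    by rewrite /k3; field.
  have h := square_sub_le x t y x0 xt ty y1.
  have -> : 2 * (y - x) ^+ 2 = (y - x) * (2 * (y - x)) by ring.
  rewrite normrM (ger0_norm yx0) ler_wpM2l// normrM.
  by rewrite normfV (ger0_norm (ler0n _ 3)) ler_pdivrMr//; lra.
have b2 : `|k2| <= 6 * (y - x) ^+ 2.
  (* This is the splitting [2 * t * (1 - t) = 2 * t - 2 * t ^ 2]; the two parts contribute [2] and
     [2 * 2] to the constant [6]. *)
  have -> : k2 = (y - x) * (x + y - 2 * t) - 2 * k3 by rewrite /k2 /k3; field.
  apply: le_trans (ler_normB _ _) _.
  rewrite normrM (ger0_norm yx0) normrM (ger0_norm (ler0n _ 2)).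
  have : `|x + y - 2 * t| <= 2 * (y - x).
    by rewrite ler_norml; apply/andP; split; lra.
  by move/(ler_wpM2l yx0); move: b3; lra.
apply: le_trans (comb_le _ _ _) _; rewrite lecR /L.
move: (ler_wpM2r (nrm0 X) b1) (ler_wpM2r (nrm0 Y) b2) (ler_wpM2r (nrm0 Z) b3).
lra.
Qed.

(** * The integral as an operator, and bounds on its norm from both sides *)

Section bop_algebra.
Context {R : realType} {H : hilbertType R}.
Implicit Types (A D P : bop H).

Lemma bop_scaleAl (k : R[i]) A D : (k *: A) * D = k *: (A * D).
Proof. exact: bop_eqP. Qed.

Lemma bop_scaleAr (k : R[i]) A D : A * (k *: D) = k *: (A * D).
Proof. by apply: bop_eqP => x; rewrite [LHS]linearZ. Qed.

Lemma bop_affine_sqr (a b : R) P :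
  (a%:C *: P + b%:C *: (1 : bop H)) ^+ 2
  = (a ^+ 2)%:C *: P ^+ 2 + (2 * a * b)%:C *: P + (b ^+ 2)%:C *: (1 : bop H).
Proof.
have -> : (2 * a * b)%:C = a%:C * b%:C + b%:C * a%:C.
  by rewrite -!rmorphM -rmorphD; congr (_%:C); ring.
rewrite !expr2 mulrDl !mulrDr !bop_scaleAl !bop_scaleAr !scalerA mulr1 mul1r.
by rewrite mulr1 scalerDl -!rmorphM -!addrA.
Qed.

Lemma normbopE A : `|A| = (opnorm A)%:C.
Proof. by []. Qed.

Lemma opnormZr (k : R) A : 0 <= k -> opnorm (k%:C *: A) = k * opnorm A.
Proof.
move=> k0; apply: complexI; rewrite -normbopE normrZ rmorphM /= normbopE.
by rewrite ger0_norm// lecR.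
Qed.

Lemma opnormD_le A D : opnorm (A + D) <= opnorm A + opnorm D.
Proof. by rewrite -lecR rmorphD; exact: opnormD. Qed.

Definition quadratic_mean (c : R) P : bop H :=
  3^-1%:C *: (P ^+ 2 + c%:C *: P + (c ^+ 2)%:C *: (1 : bop H)).

Lemma quadratic_mean_integral (c : R) P :
  riemann_integral
    (fun t : R => ((1 - t)%:C *: P + (t%:C * c%:C) *: (1 : bop H)) ^+ 2) 0 1
  = quadratic_mean c P.
Proof.
apply: riemann_integral_unique => //.
set f := (X in is_riemann_integral X).
suff -> : f = fun t => ((1 - t) ^+ 2)%:C *: P ^+ 2
    + (2 * t * (1 - t))%:C *: (c%:C *: P)
    + (t ^+ 2)%:C *: ((c ^+ 2)%:C *: (1 : bop H)).
  exact: is_riemann_integral_quadratic.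
apply/funext => t; rewrite /f -rmorphM bop_affine_sqr !scalerA -!rmorphM /=.
have -> : 2 * (1 - t) * (t * c) = 2 * t * (1 - t) * c by ring.
by rewrite exprMn.
Qed.

(** Each of the three averaged terms has norm at most [p ^ 2]. *)
Lemma opnorm_quadratic_mean_le (c p : R) P : 0 <= c -> c <= p ->
  opnorm P <= p -> opnorm (quadratic_mean c P) <= p ^+ 2.
Proof.
move=> c0 cp Pp; rewrite opnormZr//.
have P0 := opnorm_ge0 P; have p0 := le_trans P0 Pp.
have c20 : 0 <= c ^+ 2 by rewrite exprn_ge0.
have := opnormD_le (P ^+ 2 + c%:C *: P) ((c ^+ 2)%:C *: (1 : bop H)).
have := opnormD_le (P ^+ 2) (c%:C *: P).
rewrite !opnormZr//; have := opnorm_mul_le P P; rewrite -!expr2.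
have := ler_wpM2l c20 (@opnorm1_le _ H).
have : c ^+ 2 <= p ^+ 2 by rewrite ler_pXn2r.
have : opnorm P ^+ 2 <= p ^+ 2 by rewrite ler_pXn2r.
have : c * opnorm P <= p ^+ 2 by rewrite expr2 ler_pM.
lra.
Qed.

(** Three times the difference of the two sides is [|P x - c x| ^ 2]. *)
Lemma rinner_quadratic_mean_ge (c : R) P x :
  (forall y, rinner (P y) x = rinner (P x) y) ->
  c * rinner (P x) x <= rinner (quadratic_mean c P x) x.
Proof.
move=> Psym; have -> : quadratic_mean c P x
    = 3^-1%:C *: (P (P x) + c%:C *: P x + (c ^+ 2)%:C *: x) by [].
have := sqr_ge0 (rnorm (P x + (- c)%:C *: x)).
rewrite -rinnerxx !(rinnerDl, rinnerDr, rinnerZl, rinnerZr).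
rewrite (Psym (P x)) (rinnerC x (P x)).
lra.
Qed.

Lemma opnorm_quadratic_mean_ge (c : R) (M : bop H) : positive M ->
  0 <= c -> c * opnorm M ^+ 2 <= opnorm (quadratic_mean c (M ^+ 2)).
Proof.
move=> M0 c0; set q := opnorm (quadratic_mean _ _).
have [->|c_neq0] := eqVneq c 0; first by rewrite mul0r opnorm_ge0.
have cp : 0 < c by rewrite lt_neqAle eq_sym c_neq0.
have q0 : 0 <= q := opnorm_ge0 _.
have MM x y : rinner ((M ^+ 2) x) y = rinner (M x) (M y).
  by rewrite (rinnerC _ (M y)); exact: (positive_rinner_sym M (M x) y M0).
have sq x : rinner ((M ^+ 2) x) x = rnorm (M x) ^+ 2 by rewrite MM rinnerxx.
have M2 x y : rinner ((M ^+ 2) y) x = rinner ((M ^+ 2) x) y.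
  by rewrite !MM rinnerC.
(* On the unit ball, [c * |M x| ^ 2 = c * <M ^ 2 x, x>] is at most [q], by the previous lemma with
   [P = M ^ 2]. *)
have cMx x : rnorm x <= 1 -> rnorm (M x) <= Num.sqrt (q / c).
  move=> x1; rewrite -(ler_pXn2r (ltn0Sn 1)) ?nnegrE ?rnorm_ge0 ?sqrtr_ge0//.
  rewrite sqr_sqrtr ?divr_ge0// ler_pdivlMr// mulrC -sq.
  apply: le_trans (rinner_quadratic_mean_ge _ _ _ (M2 x)) _.
  apply: le_trans (rinner_bop_le _ _) _.
  by rewrite ler_piMr// exprn_ile1// rnorm_ge0.
rewrite -ler_pdivlMl// mulrC -[leRHS]sqr_sqrtr ?divr_ge0//.
by rewrite ler_pXn2r ?nnegrE ?opnorm_ge0 ?sqrtr_ge0//; exact: opnorm_rnorm_le.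
Qed.

End bop_algebra.

(** * Both inequalities, deduced from [c <= |M| ^ 2] *)

Theorem corollary3p13 (R : realType) (H : hilbertType R) (A D : bop H)
    (A_pos : positive A) (D_pos : positive D) :
  `|A * D| <=
    sqrtC `|riemann_integral
              (fun t : R => ((1 - t)%:C *: (2^-1 *: (A + D)) ^+ 2
                             + (t%:C * `|A * D|) *: (1 : bop H)) ^+ 2) 0 1|
    <= 4^-1 * `|A + D| ^+ 2.
Proof.
have half : (2^-1 : R[i]) = (2^-1 : R)%:C by rewrite fmorphV rmorph_nat.
set M := 2^-1 *: (A + D).
have M_pos : positive M.
  move=> x; rewrite (_ : inner _ _ = 2^-1 * (inner (A x) x + inner (D x) x)).
    by rewrite mulr_ge0// ?addr_ge0// invr_ge0.
  by rewrite /M bopZ bopD -linearDl; exact: linearZl_LR.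
have MN : opnorm M ^+ 2 = 4^-1 * opnorm (A + D) ^+ 2.
  by rewrite /M half opnormZr// exprMn; congr (_ * _); field.
rewrite normbopE quadratic_mean_integral !normbopE.
set c := opnorm (A * D).
have c0 : 0 <= c by exact: opnorm_ge0.
have cM : c <= opnorm M ^+ 2.
  by rewrite MN ler_pdivlMl//; exact: opnorm_mul_positive_le.
have M2 : opnorm (M ^+ 2) <= opnorm M ^+ 2.
  by rewrite [leRHS]expr2; exact: opnorm_mul_le.
set q := opnorm (quadratic_mean _ _).
(* The chain is [c * c <= c * |M| ^ 2 <= q]. *)
have cq : c ^+ 2 <= q.
  apply: le_trans (opnorm_quadratic_mean_ge c M M_pos c0).
  by rewrite expr2 ler_wpM2l.
have qM : q <= (opnorm M ^+ 2) ^+ 2.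
  exact: opnorm_quadratic_mean_le.
have q0 : 0 <= q%:C by rewrite lecR opnorm_ge0.
have -> : 4^-1 * (opnorm (A + D))%:C ^+ 2 = (opnorm M ^+ 2)%:C.
  by rewrite MN rmorphM rmorphXn fmorphV rmorph_nat.
have sq0 : 0 <= sqrtC q%:C by rewrite sqrtC_ge0.
have sqK : sqrtC q%:C ^+ 2 = (q : R)%:C by exact: sqrtCK.
(* Squaring removes the root and leaves [cq] and [qM]. *)
apply/andP; split; rewrite -(ler_pXn2r (ltn0Sn 1)) ?nnegrE ?lecR ?sqr_ge0// sqK.
  by rewrite -rmorphXn lecR.
by rewrite -rmorphXn lecR.
Qed.
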